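(* Consider a linear function $f:\mathbb{F}_q^k\to\mathbb{F}_q^l$, $\mathbf{u}\mapsto\mathbf{F}\mathbf{u}$, with $\mathbf{F}\in\mathbb{F}_q^{l\times k}$ (of rank $l$) and $k\ge q^l-1$. If the number of distinct columns of $\mathbf{F}$ is at least $q^l-1$, then all the cosets in $\mathbb{F}_q^k/\ker(f)$ will have a unit vector. Then the function distance matrix is of the form $$[\mathbf{D}_f(t,f_0,f_1,\dots,f_{q^l-1})]_{ij}=\begin{cases}2t&\text{if } i\ne j,\\0&\text{otherwise},\end{cases}$$ i.e., the diagonal entries are $0$ and the non-diagonal entries are $2t$. So the parity vectors satisfying these distance requirements (as needed for coset-wise coding) will be an error correcting code of cardinality $q^l$ and minimum distance $2t$.
   Context: $\mathbb{F}_q$ is the finite field of size $q$, $t$ is a positive integer, $d_H$ is Hamming distance and $[x]^+=\max(x,0)$. A unit vector is a vector $\mathbf{e}_j\in\mathbb{F}_q^k$ with a $1$ in coordinate $j$ and $0$s elsewhere. $\mathbb{F}_q^k/\ker(f)$ is the set of cosets of $\ker(f)$ in $\mathbb{F}_q^k$, and $f_0,\dots,f_{q^l-1}$ enumerate $\mathbb{F}_q^l=\mathrm{Im}(f)$. For $f_i,f_j\in\mathrm{Im}(f)$, $d_f(f_i,f_j)=\min\{d_H(\mathbf{u},\mathbf{u}'):f(\mathbf{u})=f_i,\ f(\mathbf{u}')=f_j\}$. The function distance matrix $\mathbf{D}_f(t,f_0,\dots,f_{q^l-1})$ has $(i,j)$ entry $[2t+1-d_f(f_i,f_j)]^+$ if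 $i\ne j$ and $0$ otherwise. In coset-wise coding, all message vectors in the same coset of $\ker(f)$ are given the same parity vector (so the message $\mathbf{u}$ is encoded as $(\mathbf{u},\mathbf{p}_i)$ when $f(\mathbf{u})=f_i$), and the distance requirement on the parity vectors $\mathbf{p}_0,\dots,\mathbf{p}_{q^l-1}$ is $d_H(\mathbf{p}_i,\mathbf{p}_j)\ge[\mathbf{D}_f(t,f_0,\dots,f_{q^l-1})]_{ij}$ for all $i,j$; its purpose is that codewords of messages with different function values are at Hamming distance at least $2t+1$. The paper describes the result as reducing the dimension of the error correction problem from $k$ to $l$ and the minimum distance requirement from $2t+1$ to $2t$.
   Formalization: Only nonzero distinct columns are counted (with the zero column counted the claim fails); the coset claim is for cosets other than ker(f), which need not contain a unit vector; ''minimum distance 2t'' is read as at least 2t; l is taken to be positive. *)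

(* Defs.v *)
From HB Require Import structures.
From mathcomp Require Import all_boot all_order all_fingroup all_algebra.

Set Implicit Arguments.
Unset Strict Implicit.
Unset Printing Implicit Defensive.

Import GRing.Theory.
Local Open Scope ring_scope.

Section FunctionCorrection.

Variable F : finFieldType.

Definition hamming (n : nat) (x y : 'cV[F]_n) : nat :=
  #|[set i | x i 0 != y i 0]|.

Definition linmap (l k : nat) (A : 'M[F]_(l, k)) (u : 'cV[F]_k) : 'cV[F]_l :=
  A *m u.

Definition ker_set (l k : nat) (f : 'cV[F]_k -> 'cV[F]_l) : {set 'cV[F]_k} :=
  [set u | f u == 0].

(* [lcosets] is taken in the additive group of F^k. *)
Definition ker_cosets (l k : nat) (f : 'cV[F]_k -> 'cV[F]_l) :
    {set {set 'cV[F]_k}} :=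
  lcosets (ker_set f) [set: 'cV[F]_k].

(* A zero column is not counted: it provides a unit vector in ker f only. *)
Definition nonzero_columns (l k : nat) (A : 'M[F]_(l, k)) : {set 'cV[F]_l} :=
  [set col j A | j : 'I_k] :\ 0.

(* The default value k of the minimum bounds every distance in F^k, so this is
   the true minimum whenever a and b both lie in the image of f. *)
Definition fun_dist (l k : nat) (f : 'cV[F]_k -> 'cV[F]_l)
    (a b : 'cV[F]_l) : nat :=
  \big[minn/k]_(u : 'cV[F]_k * 'cV[F]_k | (f u.1 == a) && (f u.2 == b))
    hamming u.1 u.2.

(* The truncated subtraction of nat is the positive part [2t + 1 - d]^+. *)
Definition fun_dist_mx (l k m t : nat) (f : 'cV[F]_k -> 'cV[F]_l)
    (e : 'I_m -> 'cV[F]_l) : 'M[nat]_m :=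
  \matrix_(i, j) if i != j then (2 * t + 1 - fun_dist f (e i) (e j))%N else 0%N.

Definition parity_requirement (m r : nat) (D : 'M[nat]_m)
    (p : 'I_m -> 'cV[F]_r) : Prop :=
  forall i j, (D i j <= hamming (p i) (p j))%N.

(* As for [fun_dist], the default value r is harmless as soon as the code has
   two distinct codewords. *)
Definition min_dist (r : nat) (C : {set 'cV[F]_r}) : nat :=
  \big[minn/r]_(x : 'cV[F]_r * 'cV[F]_r
                | [&& x.1 \in C, x.2 \in C & x.1 != x.2]) hamming x.1 x.2.

End FunctionCorrection.

(* Main.v *)
(** By counting, every nonzero vector of F^l is a column A e_j.  Hence every coset
    other than the kernel contains some e_j, and two distinct values a, b are
    attained at distance one: if A u = b and a - b = A e_j, then A (u + e_j) = a. *)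
Require Import Defs.
From mathcomp Require Import all_boot all_order all_fingroup all_algebra.

Set Implicit Arguments.
Unset Strict Implicit.
Unset Printing Implicit Defensive.

Import GRing.Theory.
Local Open Scope ring_scope.

(** The default [d] counts as one more term of the minimum, so a lower bound must be checked against
    [d] too. *)
Lemma bigminn_geqP (I : finType) (P : pred I) (G : I -> nat) (d m : nat) :
  reflect ((m <= d)%N /\ forall i, P i -> (m <= G i)%N)
    (m <= \big[minn/d]_(i | P i) G i)%N.
Proof. exact: (Order.TotalTheory.bigmin_geP (T := nat)). Qed.

Section Hamming.

Variables (F : finFieldType) (n : nat).
Implicit Types x y : 'cV[F]_n.

Lemma hamming_eq0 x y : (hamming x y == 0%N) = (x == y).
Proof.
rewrite cards_eq0; apply/eqP/eqP => [exy|->].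
  apply/colP => i; apply/eqP; move/setP/(_ i): exy.
  by rewrite !inE => /negbFE.
by apply/setP => i; rewrite !inE eqxx.
Qed.

Lemma hamming_leq x y : (hamming x y <= n)%N.
Proof. by rewrite -[leqRHS]card_ord; apply: max_card. Qed.

Lemma hamming_add_delta x j : hamming (x + delta_mx j 0) x = 1%N.
Proof.
rewrite -[RHS](cards1 j); congr #|pred_of_set _|; apply/setP => i.
rewrite !inE !mxE andbT -subr_eq0 addrAC subrr add0r.
by case: (i == j); rewrite ?oner_eq0 ?eqxx.
Qed.

Lemma min_distP (C : {set 'cV[F]_n}) (m : nat) :
  (1 < #|C|)%N ->
  reflect {in C &, forall x y, x != y -> (m <= hamming x y)%N}
    (m <= min_dist C)%N.
Proof.
move=> C1; apply: (iffP (bigminn_geqP _ _ _ _)) => [[_ dC] x y xC yC xy | dC].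
  by apply: (dC (x, y)); rewrite /= xC yC.
(* Two distinct codewords bound the default value: [m] is at most their distance, which is at most
   [n]. *)
have /card_gt1P [a [b [aC bC ab]]] := C1.
split; first exact: leq_trans (dC _ _ aC bC ab) (hamming_leq _ _).
by case=> x y /and3P [xC yC xy]; apply: dC.
Qed.

End Hamming.

Section AllNonzeroColumns.

Variables (F : finFieldType) (l k : nat) (A : 'M[F]_(l, k)).

Hypothesis hcols : (#|F| ^ l - 1 <= #|nonzero_columns A|)%N.

(** The nonzero columns lie in the complement of 0, which has [#|F| ^ l - 1] elements; [hcols] then
    forces the two sets to coincide. *)
Lemma nonzero_is_column (v : 'cV[F]_l) : v != 0 -> exists j, v = col j A.
Proof.
have sub : nonzero_columns A \subset [set~ 0].
  by apply/subsetP => w; rewrite !inE => /andP [].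
have eqN : nonzero_columns A = [set~ 0].
  by apply/eqP; rewrite eqEcard sub cardsC1 card_mx muln1 -subn1.
move=> v0; have: v \in nonzero_columns A by rewrite eqN !inE.
by rewrite !inE => /andP [_ /imsetP [j _ ->]]; exists j.
Qed.

Lemma linmap_surj (a : 'cV[F]_l) : exists u, linmap A u = a.
Proof.
have [->|/nonzero_is_column [j ->]] := eqVneq a 0.
  by exists 0; rewrite /linmap mulmx0.
by exists (delta_mx j 0); rewrite /linmap -colE.
Qed.

Lemma unit_vector_in_coset (C : {set 'cV[F]_k}) :
  C \in ker_cosets (linmap A) -> C != ker_set (linmap A) ->
  exists j : 'I_k, delta_mx j 0 \in C.
Proof.
case/lcosetsP => x _ -> neq.
(* The coset of [x] is the fibre of [linmap A] over [A *m x]; the group notation stands for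
   addition. *)
have kerE w : (w \in (x *: ker_set (linmap A))%g) = (A *m w == A *m x).
  by rewrite mem_lcoset inE /linmap mulmxDr mulmxN addrC subr_eq0.
have /nonzero_is_column [j Ej] : A *m x != 0.
  apply: contra neq => /eqP Ax0; apply/eqP/setP => w.
  by rewrite kerE Ax0 inE.
by exists j; rewrite kerE Ej -colE.
Qed.

Lemma fun_dist_eq1 (a b : 'cV[F]_l) : a != b -> fun_dist (linmap A) a b = 1%N.
Proof.
move=> ab; have [u Eu] := linmap_surj b.
have /nonzero_is_column [j Ej] : a - b != 0 by rewrite subr_eq0.
apply/eqP; rewrite eqn_leq; apply/andP; split.
  (* The minimum is a lower bound of itself, hence at most the distance of the pair
     [(u + delta_mx j 0, u)], which is 1. *)
  have /bigminn_geqP [_ /(_ (u + delta_mx j 0, u))] :=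
    leqnn (fun_dist (linmap A) a b).
  rewrite /= hamming_add_delta; apply.
  by rewrite Eu /linmap mulmxDr -colE -Ej -/(linmap A u) Eu subrKC !eqxx.
(* The default [k] is at least 1 because the index [j : 'I_k] exists. *)
apply/bigminn_geqP; split; first exact: leq_ltn_trans (ltn_ord j).
case=> x y /= /andP [/eqP Ex /eqP Ey]; rewrite lt0n hamming_eq0.
by apply: contra ab => /eqP xy; rewrite -Ex -Ey xy.
Qed.

(** Distinct indices name distinct values, at distance 1, and [2 * t + 1 - 1] is [2 * t]. *)
Lemma fun_dist_mxE (m t : nat) (e : 'I_m -> 'cV[F]_l) :
  injective e ->
  fun_dist_mx t (linmap A) e =
    \matrix_(i, j) (if i != j then (2 * t)%N else 0%N).
Proof.
move=> inj_e; apply/matrixP => i j; rewrite !mxE.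
by case: ifP => // ij; rewrite fun_dist_eq1 ?addnK // (inj_eq inj_e).
Qed.

End AllNonzeroColumns.

(** A positive [d] keeps parity vectors of distinct indices apart, so the requirement makes [p]
    injective. Conversely, an image of full size [m] forces injectivity, and distinct indices then
    give distinct codewords. With [1 < m] the minimum distance ranges over actual pairs. *)
Lemma parity_requirement_constP (F : finFieldType) (m r d : nat)
    (p : 'I_m -> 'cV[F]_r) :
  (1 < m)%N -> (0 < d)%N ->
  parity_requirement (\matrix_(i, j) (if i != j then d else 0%N)) p <->
  #|[set p i | i : 'I_m]| = m /\ (d <= min_dist [set p i | i : 'I_m])%N.
Proof.
move=> m1 d0; split=> [req | [cardp dp] i j].
  have dp i j : i != j -> (d <= hamming (p i) (p j))%N.
    by move=> ij; have := req i j; rewrite mxE ij.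
  have inj_p : injective p.
    move=> i j /eqP; rewrite -hamming_eq0 => /eqP pij; apply/eqP.
    by apply: contraLR d0 => /dp; rewrite pij leqn0 lt0n negbK.
  have cardp : #|[set p i | i : 'I_m]| = m by rewrite card_imset ?card_ord.
  split=> //; apply/min_distP; first by rewrite cardp.
  move=> _ _ /imsetP [i _ ->] /imsetP [j _ ->] pij.
  by apply: dp; apply: contra pij => /eqP ->.
rewrite mxE; case: ifP => // ij.
have inj_p : injective p.
  have /imset_injP inj : #|[set p i | i : 'I_m]| == #|'I_m|.
    by rewrite cardp card_ord.
  by move=> x y; apply: inj.
move: dp => /min_distP; apply; rewrite ?cardp ?imset_f //.
by rewrite (inj_eq inj_p).
Qed.

Theorem mainTheorem14 (F : finFieldType) (l k t : nat) (A : 'M[F]_(l, k))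
    (e : 'I_(#|F| ^ l) -> 'cV[F]_l)
    (hl : (0 < l)%N) (ht : (0 < t)%N)
    (hrank : \rank A = l)
    (hk : (#|F| ^ l - 1 <= k)%N)
    (hcols : (#|F| ^ l - 1 <= #|nonzero_columns A|)%N)
    (he : bijective e) :
  [/\ forall C : {set 'cV[F]_k},
        C \in ker_cosets (linmap A) -> C != ker_set (linmap A) ->
        exists j : 'I_k, delta_mx j 0 \in C,
      fun_dist_mx t (linmap A) e =
        \matrix_(i, j) (if i != j then (2 * t)%N else 0%N)
    & forall (r : nat) (p : 'I_(#|F| ^ l) -> 'cV[F]_r),
        parity_requirement (fun_dist_mx t (linmap A) e) p <->
        #|[set p i | i : 'I_(#|F| ^ l)]| = (#|F| ^ l)%N /\
        (2 * t <= min_dist [set p i | i : 'I_(#|F| ^ l)])%N].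
Proof.
(* Since [0 < l], the code has at least two words. *)
have q1 : (1 < #|F| ^ l)%N.
  by rewrite -(exp1n l) ltn_exp2r ?card_finNzRing_gt1.
rewrite (fun_dist_mxE hcols t (bij_inj he)); split=> //.
  exact: unit_vector_in_coset.
by move=> r p; apply: parity_requirement_constP; rewrite ?muln_gt0.
Qed.
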